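(* Let $\mathscr{A}$ be a $C^*$-algebra with unit $e$ and let $a\in\mathscr{A}$. For $j=1,2$ let $\mathbb{D}_j\subseteq\mathbb{R}$ be a subset such that $1-t\in\mathbb{D}_j$ whenever $t\in\mathbb{D}_j$, and let $f_j:\mathbb{D}_j\to[0,\infty)$ be a mapping such that $f_j(t)+f_j(1-t)=1$ for all $t\in\mathbb{D}_j$. Then for any $\xi_1\in\mathbb{D}_1$, $\xi_2\in\mathbb{D}_2$ and any $\alpha,\beta,\gamma\in\mathbb{C}\setminus\{0\}$, $$\begin{aligned} v^6(a)\leq{}&\frac{\max\{1,|\alpha-1|^2\}}{2|\alpha|^2}\left\|\,|a^*|^4+|a|^4\right\|\,\|a\|^2+\frac{f_1(1-\xi_1)\max\{1,|\beta-1|^2\}}{|\alpha\beta|^2}\|a^2\|^2\|a\|^2\\ &+\frac{f_1(1-\xi_1)f_2(1-\xi_2)}{|\alpha\beta|^2}v^2(a^3)+\frac{f_1(1-\xi_1)\left(f_2(\xi_2)+2\max\{1,|\beta-1|\}\right)}{|\alpha\beta|^2}\|a^2\|\,\|a\|\,v(a^3)\\ &+\frac{\left(f_1(\xi_1)+2\max\{1,|\alpha-1|\}\right)\max\{1,|\gamma-1|\}}{2|\alpha|^2|\gamma|}\left\|\,|a^*|^2+|a|^2\right\|\,\|a^2\|\,\|a\|^2\\ &+\frac{f_1(\xi_1)+2\max\{1,|\alpha-1|\}}{2|\alpha|^2|\gamma|}\left\|\,|a^*|^2+|a|^2\right\|\,\|a\|\,v(a^3). \end{aligned}$$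
   Context: $\mathcal{S}(\mathscr{A})$ is the state space of $\mathscr{A}$, i.e. the set of positive linear functionals $\varphi$ on $\mathscr{A}$ with $\varphi(e)=1$. The numerical radius of $a\in\mathscr{A}$ is $v(a)=\sup\{|\varphi(a)|:\varphi\in\mathcal{S}(\mathscr{A})\}$, and $v^k(a)$ means $(v(a))^k$. $\|\cdot\|$ is the $C^*$-norm, $|a|^2=a^*a$, $|a^*|^2=aa^*$, $|a|^4=(a^*a)^2$ and $|a^*|^4=(aa^* )^2$. *)

(* Defs.v *)
From HB Require Import structures.
From mathcomp Require Import all_boot all_order all_algebra.
From mathcomp Require Import complex.
From mathcomp Require Import all_classical all_reals all_analysis.

Set Implicit Arguments.
Unset Strict Implicit.
Unset Printing Implicit Defensive.

Import Order.TTheory GRing.Theory Num.Theory.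
Import numFieldNormedType.Exports.
Import ComplexField.Normc.

Local Open Scope classical_set_scope.
Local Open Scope ring_scope.
Local Open Scope complex_scope.

(* Algebras in MathComp are nontrivial, so the unit of [A] is not 0; the zero
   algebra is excluded (it has no states). The norm and its completeness are
   axiomatized here because Hierarchy Builder rejects a structure combining
   the normed modules of MathComp-Analysis with ring structures (no declared
   join of [PzSemiRing] and [SemiNormedZmodule] lies above [NumDomain]).
   [normc] is the [R]-valued modulus on [R[i]]. *)
HB.mixin Record isCStarAlgebra (R : realType) A & GRing.Algebra R[i] A := {
  cnorm : A -> R ;
  cnorm_triangle : forall x y : A, cnorm (x + y) <= cnorm x + cnorm y ;
  cnormZ : forall (c : R[i]) (x : A), cnorm (c *: x) = normc c * cnorm x ;
  cnorm_eq0 : forall x : A, cnorm x = 0 -> x = 0 ;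
  cnorm_complete : forall u : nat -> A,
    (forall e : R, 0 < e -> exists N : nat, forall m n : nat,
       (N <= m)%N -> (N <= n)%N -> cnorm (u m - u n) < e) ->
    exists l : A, cnorm (u n - l) @[n --> \oo] --> (0 : R) ;
  cnorm_mul_le : forall x y : A, cnorm (x * y) <= cnorm x * cnorm y ;
  star : A -> A ;
  starK : forall x : A, star (star x) = x ;
  starD : forall x y : A, star (x + y) = star x + star y ;
  starZ : forall (c : R[i]) (x : A), star (c *: x) = c^*%C *: star x ;
  starM : forall x y : A, star (x * y) = star y * star x ;
  cnorm_starM : forall x : A, cnorm (star x * x) = cnorm x ^+ 2 }.

#[short(type="cstarAlgType")]
HB.structure Definition CStarAlgebra (R : realType) :=
  {A of GRing.Algebra R[i] A & isCStarAlgebra R A}.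

(* [0 <= z] for [z : R[i]] means that [z] is real and nonnegative. *)
Definition state_space (R : realType) (A : cstarAlgType R) :
    set {scalar A} :=
  [set phi : {scalar A} | (forall x : A, 0 <= phi (star x * x)) /\ phi 1 = 1].

Arguments state_space {R} A.

Definition numerical_radius (R : realType) (A : cstarAlgType R) (a : A) : R :=
  sup [set normc (phi a) | phi in state_space A].

(* Main.v *)
Require Import Defs.
From HB Require Import structures.
From mathcomp Require Import all_boot all_order all_algebra.
From mathcomp Require Import complex.
From mathcomp Require Import all_classical all_reals all_analysis.
From mathcomp Require Import ring lra.

(** For one state [phi], the theorem follows from Buzano's inequality
      [|c| |phi x| |phi w| <= max 1 |c - 1| * s x * s (star w) + |phi (w * x)|],
    where [s x = sqrt (phi (star x * x))] ([state_buzano]). It is used with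
    [x = w = a] and [c = alpha], and with [x = a ^+ 2], [w = a] and [c = beta] or
    [c = gamma]. The first instance, squared and multiplied by [|phi a| ^+ 2],
    bounds [|phi a| ^+ 6] by three terms. In them
    - [s a * s (star a)] and its square are at most half the norms of
      [a * star a + star a * a] and of the sum of the squares of its terms;
    - [|phi (a ^+ 2)| |phi a| ^+ 2] is estimated with [gamma];
    - [|phi (a ^+ 2)| ^+ 2 |phi a| ^+ 2] is a convex combination, with weights
      [f1 xi1] and [f1 (1 - xi1)], of two copies of itself, one estimated with
      [gamma] and the other with [beta]; [f2] likewise splits the resulting
      [|phi (a ^+ 3)| ^+ 2].
    This computation with real numbers is [sextic_bound]; the supremum over states
    is taken at the end ([numerical_radius_exp_le]).

    All this rests on the fact that a state, which is only assumed positive, has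
    norm at most [1] ([state_le_cnorm]). For self-adjoint [h] with
    [cnorm h <= 1 / 4], the element [1 - h] has a self-adjoint square root,
    obtained by a contraction argument ([sqrt_one_sub]); hence [phi h <= 1], which
    gives [phi h <= 4 * cnorm h] for all self-adjoint [h]. Applying this to the
    powers [h ^+ (2 ^ n)] and using Cauchy-Schwarz removes the factor 4
    ([state_sa_le_cnorm]), and [|phi x| ^+ 2 <= phi (star x * x)] handles arbitrary
    [x]. *)

Set Implicit Arguments.
Unset Strict Implicit.
Unset Printing Implicit Defensive.

Import Order.TTheory GRing.Theory Num.Theory.
Import numFieldNormedType.Exports.
Import ComplexField.Normc.

Local Open Scope classical_set_scope.
Local Open Scope ring_scope.
Local Open Scope complex_scope.

(** * Moduli and real inequalities *)

Section Scalars.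
Variable R : realType.
Implicit Type z : R[i].

Lemma normc_sqr z : normc z ^+ 2 = complex.Re z ^+ 2 + complex.Im z ^+ 2 :> R.
Proof. by case: z => u v /=; rewrite sqr_sqrtr // addr_ge0 // sqr_ge0. Qed.

Lemma normc_ge0 z : 0 <= normc z :> R.
Proof. by case: z => u v /=; rewrite sqrtr_ge0. Qed.

Lemma normc_conj z : normc z^* = normc z :> R.
Proof. by case: z => u v /=; rewrite sqrrN. Qed.

Lemma normc_gt0 z : z != 0 -> 0 < normc z :> R.
Proof.
move=> z_neq0; rewrite lt_neqAle normc_ge0 andbT eq_sym.
by apply: contra_neq z_neq0 => /eq0_normc.
Qed.

Lemma half_normc : normc (2^-1 : R[i]) = 2^-1 :> R.
Proof.
rewrite normcV; congr _^-1; rewrite -[2]/(1 + 1 : R[i]) /= addr0 expr0n addr0.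
by rewrite sqrtr_sqr ger0_norm.
Qed.

Lemma half_conjc : (2^-1 : R[i])^* = 2^-1.
Proof. by rewrite conjc_inv conjc_nat. Qed.

Lemma max1_sqr (t : R) : 0 <= t ->
  Num.max 1 (t ^+ 2) = Num.max 1 t ^+ 2.
Proof.
move=> t_ge0; have [t_le1|t_gt1] := lerP t 1.
  by rewrite max_l ?expr1n // expr_le1.
by rewrite max_r // ltW // expr_gt1.
Qed.

(** Taking [2 ^ n]-th roots makes any multiplicative constant [K] disappear in
    the limit. Bernoulli's inequality replaces the limit: if [y < x], the powers
    of [x / y] are unbounded. *)
Lemma pow_bounded_le (x y K : R) : 0 <= y ->
  (forall n, x ^+ (2 ^ n) <= K * y ^+ (2 ^ n)) -> x <= y.
Proof.
move=> y_ge0 bound; rewrite leNgt; apply/negP => lt_yx.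
have [y0|y_neq0] := eqVneq y 0.
  by have := bound 0%N; move: lt_yx; rewrite y0 expn0 !expr1 mulr0; lra.
have y_gt0 : 0 < y by rewrite lt_neqAle eq_sym y_neq0.
pose d := x / y - 1.
have d_gt0 : 0 < d by rewrite subr_gt0 ltr_pdivlMr // mul1r.
pose N := Num.truncn (K / d).
have : x ^+ (2 ^ N) / y ^+ (2 ^ N) <= K.
  by rewrite ler_pdivrMr ?exprn_gt0.
rewrite -expr_div_n.
have -> : x / y = 1 + d by rewrite /d addrC subrK.
apply/negP; rewrite -ltNge.
have bern m : 1 + m%:R * d <= (1 + d) ^+ m.
  elim: m => [|m IHm]; first by rewrite mul0r addr0 expr0.
  rewrite exprS -natr1; have := ler_wpM2l (ltW (addr_gt0 ltr01 d_gt0)) IHm.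
  by apply: le_trans; have := ler0n R m; nra.
apply: lt_le_trans (bern _).
have lt_Kd : K / d < (2 ^ N)%:R.
  by apply: lt_le_trans (truncnS_gt _) _; rewrite ler_nat ltn_expl.
by move: lt_Kd; rewrite ltr_pdivrMr //; lra.
Qed.

End Scalars.

(** * The norm and the involution *)

Section CStarNorm.
Variables (R : realType) (A : cstarAlgType R).
Implicit Types x y h : A.

Lemma cnorm0 : cnorm (0 : A) = 0.
Proof. by rewrite -(scale0r (0 : A)) cnormZ normc0 mul0r. Qed.

Lemma cnormN x : cnorm (- x) = cnorm x.
Proof. by rewrite -scaleN1r cnormZ normcN normc1 mul1r. Qed.

Lemma cnorm_ge0 x : 0 <= cnorm x.
Proof.
have := cnorm_triangle x (- x); rewrite subrr cnorm0 cnormN.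
by rewrite -mulr2n pmulrn_lge0.
Qed.

Lemma cnormB x y : cnorm (x - y) = cnorm (y - x).
Proof. by rewrite -opprB cnormN. Qed.

Lemma star0 : star (0 : A) = 0.
Proof. by have := starZ 0 (0 : A); rewrite conjc0 !scale0r. Qed.

Lemma starN x : star (- x) = - star x.
Proof. by rewrite -scaleN1r starZ rmorphN1 scaleN1r. Qed.

Lemma star1 : star (1 : A) = 1.
Proof. by have := starM (star 1) (1 : A); rewrite mulr1 starK mulr1 => <-. Qed.

Lemma cnorm_star x : cnorm (star x) = cnorm x.
Proof.
suff le_star y : cnorm y <= cnorm (star y).
  by apply/le_anti/andP; split=> //; have := le_star (star x); rewrite starK.
have := cnorm_mul_le (star y) y; rewrite cnorm_starM expr2.
have [y0 _|y_neq0] := eqVneq (cnorm y) 0; first by rewrite y0 cnorm_ge0.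
by rewrite ler_pM2r // lt_neqAle eq_sym y_neq0 cnorm_ge0.
Qed.

(** Replaces uniqueness of limits: an element whose norm is at most a fixed
    multiple of every small [e] is [0]. *)
Lemma eq0_of_cnorm_small (K : R) x :
  (forall e : R, 0 < e -> e <= 1 -> cnorm x <= K * e) -> x = 0.
Proof.
move=> small; apply: cnorm_eq0; apply/le_anti; rewrite cnorm_ge0 andbT.
rewrite leNgt; apply/negP => x_gt0.
have K_gt0 : 0 < K.
  by have := small 1 ltr01 (lexx 1); rewrite mulr1; apply: lt_le_trans.
pose e := Num.min 1 (cnorm x / (2 * K)).
have e_gt0 : 0 < e by rewrite lt_min ltr01 divr_gt0 // mulr_gt0.
have e_le1 : e <= 1 by rewrite ge_min lexx.
have Ke : K * e <= cnorm x / 2.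
  have -> : cnorm x / 2 = K * (cnorm x / (2 * K)) by field; rewrite gt_eqF.
  by rewrite ler_pM2l // ge_min lexx orbT.
have := small e e_gt0 e_le1; lra.
Qed.

Lemma sqr_subE x y : x * x - y * y = x * (x - y) + (x - y) * y.
Proof. by rewrite mulrBr mulrBl addrA subrK. Qed.

Lemma starX h n : star h = h -> star (h ^+ n) = h ^+ n.
Proof.
move=> h_sa; elim: n => [|n IHn]; first by rewrite expr0 star1.
by rewrite exprS starM IHn h_sa -exprSr exprS.
Qed.

(** On self-adjoint elements the C*-identity reads [cnorm (h * h) = cnorm h ^+ 2],
    so the norm commutes with repeated squaring. *)
Lemma cnorm_sa_pow2 h n : star h = h -> cnorm (h ^+ (2 ^ n)) = cnorm h ^+ (2 ^ n).
Proof.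
move=> h_sa; elim: n => [|n IHn]; first by rewrite expn0 !expr1.
by rewrite expnSr !exprM -IHn -cnorm_starM starX // expr2.
Qed.

(** * Square roots near the unit *)

(** A square root of [1 - h] is sought as [1 - y]; the equation
    [(1 - y) ^+ 2 = 1 - h] is the fixed point equation of
    [F y = (h + y * y) / 2]. For [cnorm h <= 1 / 4] this [F] preserves the ball of
    radius [1 / 4] and contracts it by the factor [1 / 4], so the iterates from
    [0] converge in norm. No commutativity is involved, and the iterates stay
    self-adjoint. *)
Section SquareRoot.
Variable h : A.
Hypotheses (h_sa : star h = h) (h_small : cnorm h <= 4^-1).

Let F y := (2^-1 : R[i]) *: (h + y * y).
Let u n := iter n F 0.

Lemma sqrt_iter_lip x y :
  cnorm (F x - F y) <= 2^-1 * (cnorm x + cnorm y) * cnorm (x - y).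
Proof.
rewrite -scalerBr cnormZ half_normc opprD addrACA subrr add0r sqr_subE.
rewrite -mulrA ler_pM2l ?invr_gt0 //.
apply: le_trans (cnorm_triangle _ _) _; rewrite [leRHS]mulrDl.
rewrite lerD ?cnorm_mul_le //.
by rewrite [leRHS]mulrC cnorm_mul_le.
Qed.

Lemma sqrt_iter_bound n : cnorm (u n) <= 4^-1.
Proof.
elim: n => [|n IHn]; first by rewrite cnorm0 invr_ge0.
rewrite /u iterS -/(u n) /F cnormZ half_normc.
have := cnorm_triangle h (u n * u n); have := cnorm_mul_le (u n) (u n).
have := cnorm_ge0 (u n); move: (cnorm_ge0 h) h_small IHn; nra.
Qed.

Lemma sqrt_iter_sa n : star (u n) = u n.
Proof.
elim: n => [|n IHn]; first exact: star0.
by rewrite /u iterS -/(u n) /F starZ half_conjc starD starM h_sa IHn.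
Qed.

(** Comparing [u (n + k)] with [u n] directly, by induction on [n], avoids
    summing a geometric series. *)
Lemma sqrt_iter_geometric n k : cnorm (u (n + k) - u n) <= 2^-1 * (4^-1) ^+ n.
Proof.
elim: n => [|n IHn].
  rewrite subr0 expr0; apply: le_trans (sqrt_iter_bound _) _; lra.
rewrite addSn {1}/u iterS -/(u _) {2}/u iterS -/(u n).
apply: le_trans (sqrt_iter_lip _ _) _; rewrite exprS.
move: (sqrt_iter_bound (n + k)) (sqrt_iter_bound n) IHn.
move: (cnorm_ge0 (u (n + k) - u n)); nra.
Qed.

Lemma sqrt_iter_cauchy (e : R) : 0 < e ->
  exists N : nat, forall m n : nat, (N <= m)%N -> (N <= n)%N ->
    cnorm (u m - u n) < e.
Proof.
move=> e_gt0; pose N := Num.truncn e^-1; exists N => m n leNm leNn.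
have geoN k : (N <= k)%N -> cnorm (u k - u N) <= 2^-1 * (4^-1) ^+ N.
  by move=> leNk; rewrite -(subnKC leNk) sqrt_iter_geometric.
have smallN : (4^-1 : R) ^+ N < e.
  rewrite exprVn -ltf_pV2 ?posrE ?invr_gt0 ?exprn_gt0 // invrK.
  apply: lt_le_trans (truncnS_gt _) _.
  by rewrite -natrX ler_nat ltn_expl.
have -> : u m - u n = (u m - u N) + (u N - u n) by rewrite subrKA.
apply: le_lt_trans (cnorm_triangle _ _) _; rewrite [cnorm (u N - _)]cnormB.
by move: (geoN m leNm) (geoN n leNn) smallN; lra.
Qed.

(** This makes [1 - h] positive in the sense [1 - h = star z * z], the only
    positivity that the definition of a state speaks of. *)
Lemma sqrt_one_sub : exists y : A, star y = y /\ y * y = 1 - h.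
Proof.
have [l ul] := @cnorm_complete R A u sqrt_iter_cauchy.
have ul_lt e : 0 < e -> exists n, cnorm (u n - l) < e /\ cnorm (u n.+1 - l) < e.
  move=> e_gt0; have /cvgr0Pnorm_lt/(_ e e_gt0) [N _ Nlt] := ul.
  exists N; split.
    by have := Nlt N (leqnn N); rewrite /= ger0_norm ?cnorm_ge0.
  by have := Nlt N.+1 (leqnSn N); rewrite /= ger0_norm ?cnorm_ge0.
have l_sa : star l = l.
  apply/eqP; rewrite -subr_eq0; apply/eqP.
  apply: (@eq0_of_cnorm_small 2) => e e_gt0 _.
  have [n [lt_n _]] := ul_lt e e_gt0.
  have -> : star l - l = - star (u n - l) + (u n - l).
    by rewrite starD starN sqrt_iter_sa opprB subrKA.
  apply: le_trans (cnorm_triangle _ _) _.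
  by rewrite cnormN cnorm_star; lra.
have l_fix : F l = l.
  apply/eqP; rewrite -subr_eq0; apply/eqP.
  apply: (@eq0_of_cnorm_small 2) => e e_gt0 e_le1.
  have [n [lt_n lt_Sn]] := ul_lt e e_gt0.
  (* [u n.+1] is convertible to [F (u n)] *)
  have -> : F l - l = (F l - F (u n)) + (u n.+1 - l) by rewrite subrKA.
  apply: le_trans (cnorm_triangle _ _) _.
  have := sqrt_iter_lip l (u n); rewrite [cnorm (l - _)]cnormB.
  have : cnorm l <= cnorm (u n) + cnorm (u n - l).
    have -> : cnorm l = cnorm (u n + (l - u n)) by rewrite addrC subrK.
    by rewrite [cnorm (u n - l)]cnormB cnorm_triangle.
  move=> l_le lip.
  have sum_le2 : cnorm l + cnorm (u n) <= 2.
    by move: (sqrt_iter_bound n) lt_n e_le1 l_le; lra.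
  have := ler_wpM2r (cnorm_ge0 (u n - l)) sum_le2.
  by move: lip lt_n lt_Sn; rewrite -mulrA; lra.
exists (1 - l); split; first by rewrite starD starN star1 l_sa.
have two_l : l + l = h + l * l.
  by rewrite -mulr2n -scaler_nat -[in LHS]l_fix scalerA mulfV ?scale1r //.
have -> : h = l + l - l * l by rewrite two_l addrK.
by rewrite mulrBr mulr1 mulrBl mul1r !opprD !opprK !addrA.
Qed.

End SquareRoot.
End CStarNorm.

(** * States *)

Section States.
Variables (R : realType) (A : cstarAlgType R) (phi : {scalar A}).
Hypothesis phi_state : state_space A phi.
Implicit Types (x y w h : A) (c : R[i]).

(** The norm of the vector [x e] in the GNS construction of [phi], that is for
    the positive semidefinite form [(x, y) |-> phi (star y * x)]. *)
Definition state_seminorm x : R := Num.sqrt (complex.Re (phi (star x * x))).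

Lemma state_pos x : 0 <= phi (star x * x).
Proof. by case: phi_state. Qed.

Lemma state1 : phi 1 = 1.
Proof. by case: phi_state. Qed.

Lemma state_Re_ge0 x : 0 <= complex.Re (phi (star x * x)).
Proof. by have := state_pos x; rewrite lecE => /andP[]. Qed.

Lemma state_posE x : phi (star x * x) = (state_seminorm x ^+ 2)%:C.
Proof.
rewrite sqr_sqrtr ?state_Re_ge0 //; have := ger0_Im (state_pos x).
by case: (phi _) => u v /= ->.
Qed.

Lemma state_seminorm_ge0 x : 0 <= state_seminorm x.
Proof. exact: sqrtr_ge0. Qed.

(** Polarization: the form takes real values at [x + y] and at [x + 'i y], which
    determines the imaginary and the real part of the defect of symmetry. *)
Lemma state_hermitian x y : phi (star y * x) = (phi (star x * y))^*.
Proof.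
have polarized c :
    complex.Im (c * phi (star x * y) + c^* * phi (star y * x)) = 0.
  have := ger0_Im (state_pos (x + c *: y)).
  rewrite starD starZ mulrDl !mulrDr -!scalerAl -!scalerAr.
  rewrite !linearD /= !linearZ /= !state_posE mulrA.
  have -> : c^* * c = (complex.Re c ^+ 2 + complex.Im c ^+ 2)%:C.
    by case: c => u v; apply/eqP; rewrite eq_complex /=; apply/andP; split;
       apply/eqP; ring.
  case: (c * _) => u1 v1; case: (c^* * _) => u2 v2 /=.
  lra.
have := polarized 1; have := polarized 'i%C.
case: (phi _) => u1 v1; case: (phi _) => u2 v2 /= h1 h2.
apply/eqP; rewrite eq_complex /=; apply/andP; split; apply/eqP; lra.
Qed.

Lemma state_star x : phi (star x) = (phi x)^*.
Proof. by have := state_hermitian 1 x; rewrite mulr1 star1 mul1r. Qed.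

Lemma state_seminorm_shift x y c :
  state_seminorm (x + c *: y) ^+ 2 = state_seminorm x ^+ 2
    + 2 * complex.Re (c * phi (star x * y))
    + normc c ^+ 2 * state_seminorm y ^+ 2.
Proof.
have expand : phi (star (x + c *: y) * (x + c *: y)) =
    (state_seminorm x ^+ 2)%:C + c * phi (star x * y)
    + (c^* * (phi (star x * y))^* + c^* * (c * (state_seminorm y ^+ 2)%:C)).
  rewrite starD starZ mulrDl !mulrDr -!scalerAl -!scalerAr.
  by rewrite !linearD /= !linearZ /= !state_posE (state_hermitian x y).
have -> : state_seminorm (x + c *: y) ^+ 2 =
    complex.Re (phi (star (x + c *: y) * (x + c *: y))) by rewrite state_posE.
rewrite expand normc_sqr.
by case: c {expand} => u v; case: (phi _) => u1 v1 /=; ring.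
Qed.

(** The usual discriminant argument, with coefficient [- t r^*] so that the
    quadratic polynomial in the real variable [t] has real coefficients. The form
    may be degenerate, hence the separate case where [y] has seminorm [0]. *)
Lemma state_cauchy_schwarz x y :
  normc (phi (star x * y)) <= state_seminorm x * state_seminorm y.
Proof.
set r := phi _.
have quadratic t : 0 <= state_seminorm x ^+ 2 - 2 * t * normc r ^+ 2
    + t ^+ 2 * normc r ^+ 2 * state_seminorm y ^+ 2.
  have := sqr_ge0 (state_seminorm (x + (- t%:C * r^*) *: y)).
  rewrite state_seminorm_shift -/r normcM normc_conj normcN exprMn.
  rewrite [normc t%:C ^+ 2]normc_sqr /= expr0n addr0.
  suff -> : complex.Re (- t%:C * r^* * r) = - t * normc r ^+ 2 by lra.
  by rewrite normc_sqr; case: r => u v /=; ring.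
rewrite -(ler_pXn2r (ltn0Sn 1)) ?nnegrE ?normc_ge0 ?mulr_ge0
  ?state_seminorm_ge0 //.
rewrite exprMn; set p := state_seminorm x ^+ 2 in quadratic *.
set q := state_seminorm y ^+ 2 in quadratic *.
set n := normc r ^+ 2 in quadratic *.
have [q0|q_neq0] := eqVneq q 0.
  rewrite q0 mulr0; have [->//|n_neq0] := eqVneq n 0.
  (* here [p - 2 t n >= 0] for all [t]; this [t] makes it [-1] *)
  have := quadratic ((p + 1) / (2 * n)); rewrite q0 mulr0 addr0.
  have -> : p - 2 * ((p + 1) / (2 * n)) * n = -1 by field.
  lra.
have q_gt0 : 0 < q by rewrite lt_neqAle eq_sym q_neq0 sqr_ge0.
have := quadratic q^-1.
have -> : p - 2 * q^-1 * n + q^-1 ^+ 2 * n * q = (p * q - n) / q by field.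
by rewrite pmulr_lge0 ?invr_gt0 // subr_ge0.
Qed.

Lemma state_sqr_le x : normc (phi x) <= state_seminorm x.
Proof.
have := state_cauchy_schwarz 1 x; rewrite star1 mul1r.
by rewrite {1}/state_seminorm star1 mul1r state1 sqrtr1 mul1r.
Qed.

Lemma state_sa_real h : star h = h -> complex.Im (phi h) = 0.
Proof.
move=> h_sa; have := state_star h; rewrite h_sa.
by case: (phi h) => u v [] /= v_eq; lra.
Qed.

Lemma state_sa_le1 h : star h = h -> cnorm h <= 4^-1 -> complex.Re (phi h) <= 1.
Proof.
move=> h_sa h_small; have [y [y_sa yy]] := sqrt_one_sub h_sa h_small.
have := state_Re_ge0 y; rewrite y_sa yy linearB /= state1.
by case: (phi h) => u v /=; lra.
Qed.

(** A first, non-optimal bound: [h / (4 * cnorm h)] has norm [1 / 4], so [1] minus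
    it is a square and [phi] is nonnegative there. *)
Lemma state_sa_bounded h : star h = h -> complex.Re (phi h) <= 4 * cnorm h.
Proof.
move=> h_sa; have [h0|h_neq0] := eqVneq (cnorm h) 0.
  by rewrite h0 (cnorm_eq0 _ h0) linear0 mulr0.
have h_gt0 : 0 < cnorm h by rewrite lt_neqAle eq_sym h_neq0 cnorm_ge0.
pose t := (4 * cnorm h)^-1.
have t_gt0 : 0 < t by rewrite invr_gt0 mulr_gt0.
have := @state_sa_le1 (t%:C *: h).
rewrite starZ conjc_real h_sa cnormZ => /(_ erefl).
have -> : normc t%:C = t by rewrite /= expr0n addr0 sqrtr_sqr gtr0_norm.
have -> : t * cnorm h = 4^-1 by rewrite /t; field.
move=> /(_ (lexx _)); rewrite linearZ /=.
have -> : complex.Re (t%:C * phi h) = t * complex.Re (phi h).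
  by case: (phi h) => u v /=; ring.
by rewrite /t mulrC ler_pdivrMr ?mulr_gt0 // mul1r.
Qed.

Lemma state_sa_sqr h : star h = h ->
  complex.Re (phi h) ^+ 2 <= complex.Re (phi (h ^+ 2)).
Proof.
move=> h_sa; have := state_sqr_le h.
rewrite -(ler_pXn2r (ltn0Sn 1)) ?nnegrE ?normc_ge0 ?state_seminorm_ge0//.
by rewrite sqr_sqrtr ?state_Re_ge0 // normc_sqr state_sa_real // h_sa expr0n addr0.
Qed.

(** Cauchy-Schwarz gives [phi h ^+ (2 ^ n) <= phi (h ^+ (2 ^ n))], and the norm of
    [h ^+ (2 ^ n)] is [cnorm h ^+ (2 ^ n)]; the factor 4 of the crude bound is lost
    after taking roots. *)
Lemma state_sa_le_cnorm h : star h = h -> complex.Re (phi h) <= cnorm h.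
Proof.
move=> h_sa; have [h_neg|h_pos] := lerP (complex.Re (phi h)) 0.
  exact: le_trans h_neg (cnorm_ge0 h).
apply: (@pow_bounded_le _ _ _ 4); rewrite ?cnorm_ge0 // => n.
rewrite -cnorm_sa_pow2 //.
apply: le_trans (state_sa_bounded (starX _ h_sa)).
elim: n => [|n IHn]; first by rewrite expn0 !expr1.
rewrite expnSr !exprM; apply: le_trans (state_sa_sqr (starX _ h_sa)).
have pow_ge0 : 0 <= complex.Re (phi h) ^+ (2 ^ n) by rewrite exprn_ge0 // ltW.
by rewrite ler_pXn2r // nnegrE // (le_trans pow_ge0 IHn).
Qed.

Lemma state_seminorm_le x : state_seminorm x <= cnorm x.
Proof.
rewrite -(ler_pXn2r (ltn0Sn 1)) ?nnegrE ?state_seminorm_ge0 ?cnorm_ge0//.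
rewrite sqr_sqrtr ?state_Re_ge0 // -cnorm_starM state_sa_le_cnorm //.
by rewrite starM starK.
Qed.

Lemma state_le_cnorm x : normc (phi x) <= cnorm x.
Proof. exact: le_trans (state_sqr_le x) (state_seminorm_le x). Qed.

Lemma state_mul_le x w :
  normc (phi (w * x)) <= state_seminorm x * state_seminorm (star w).
Proof. by have := state_cauchy_schwarz (star w) x; rewrite starK mulrC. Qed.

(** Buzano's inequality with a parameter. Let [P] be the projection onto the unit
    vector [e] of the GNS space. The operator [1 - c P] multiplies the range of [P]
    by [1 - c] and its orthogonal complement by [1], so its norm is at most
    [max 1 |c - 1|]; apply Cauchy-Schwarz to [(1 - c P) x] and [star w]. *)
Lemma state_buzano x w c :
  normc c * normc (phi x * phi w) <=
    Num.max 1 (normc (c - 1)) * (state_seminorm x * state_seminorm (star w))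
    + normc (phi (w * x)).
Proof.
pose M := Num.max 1 (normc (c - 1)).
have M_ge1 : 1 <= M by rewrite le_max lexx.
have M_ge : normc (c - 1) <= M by rewrite le_max lexx orbT.
pose z := x - (c * phi x) *: 1.
have z_le : state_seminorm z <= M * state_seminorm x.
  rewrite -(ler_pXn2r (ltn0Sn 1)) ?nnegrE ?mulr_ge0 ?state_seminorm_ge0 //;
    last by rewrite (le_trans ler01).
  have -> : z = x + (- (c * phi x)) *: 1 by rewrite scaleNr.
  rewrite state_seminorm_shift mulr1 state_star.
  have -> : state_seminorm 1 = 1 by rewrite /state_seminorm star1 mul1r state1 sqrtr1.
  have -> : state_seminorm x ^+ 2 + 2 * complex.Re (- (c * phi x) * (phi x)^*)
      + normc (- (c * phi x)) ^+ 2 * 1 ^+ 2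
    = (state_seminorm x ^+ 2 - normc (phi x) ^+ 2)
      + normc (c - 1) ^+ 2 * normc (phi x) ^+ 2.
    rewrite !normc_sqr; case: c {M M_ge1 M_ge z} => u v; case: (phi x) => u1 v1 /=.
    by ring.
  rewrite exprMn.
  have le1 : normc (phi x) ^+ 2 <= state_seminorm x ^+ 2.
    by rewrite ler_pXn2r ?nnegrE ?normc_ge0 ?state_seminorm_ge0 ?state_sqr_le.
  have le2 : normc (c - 1) ^+ 2 <= M ^+ 2.
    by rewrite ler_pXn2r ?nnegrE ?normc_ge0 // (le_trans ler01).
  have le3 : 1 <= M ^+ 2 by rewrite exprn_ege1.
  have := ler_wpM2r (sqr_ge0 (normc (phi x))) le2.
  have : 0 <= state_seminorm x ^+ 2 - normc (phi x) ^+ 2 by rewrite subr_ge0.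
  by move=> /ler_wpM2r/(_ _ _ le3); lra.
have phi_wz : phi (w * z) = phi (w * x) - c * (phi x * phi w).
  by rewrite mulrBr -scalerAr mulr1 linearB /= linearZ /= mulrA.
rewrite -normcM.
have -> : c * (phi x * phi w) = phi (w * x) + - phi (w * z).
  by rewrite phi_wz opprB addrC subrK.
apply: le_trans (le_normcD _ _) _; rewrite normcN addrC lerD2r.
apply: le_trans (state_mul_le _ _) _.
by rewrite mulrA ler_wpM2r ?state_seminorm_ge0.
Qed.

End States.

(** * The numerical radius *)

Section NumericalRadius.
Variables (R : realType) (A : cstarAlgType R).
Implicit Types x : A.

Lemma state_le_numerical_radius (phi : {scalar A}) x :
  state_space A phi -> normc (phi x) <= numerical_radius x.
Proof.
move=> phi_state; apply: ub_le_sup; last by exists phi.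
by exists (cnorm x) => _ [psi psi_state <-]; exact: state_le_cnorm.
Qed.

Lemma numerical_radius_ge0 x : 0 <= numerical_radius x.
Proof.
have [no_state|/set0P[phi phi_state]] := eqVneq (state_space A) set0.
  by rewrite /numerical_radius no_state image_set0 sup0.
exact: le_trans (normc_ge0 _) (state_le_numerical_radius x phi_state).
Qed.

(** Bounds on powers pass to the supremum because [C] has a [k]-th root; when
    there is no state, the supremum is [0] by convention, and this is where
    [0 <= C] is needed. *)
Lemma numerical_radius_exp_le x (k : nat) (C : R) : (0 < k)%N -> 0 <= C ->
  (forall phi : {scalar A}, state_space A phi -> normc (phi x) ^+ k <= C) ->
  numerical_radius x ^+ k <= C.
Proof.
move=> k_gt0 C_ge0 bound.
have [no_state|/set0P[phi0 phi0_state]] := eqVneq (state_space A) set0.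
  by rewrite /numerical_radius no_state image_set0 sup0 expr0n gtn_eqF.
pose c := C `^ k%:R^-1.
have cK : c ^+ k = C.
  rewrite -powR_mulrn ?powR_ge0 // -powRrM mulVf ?powRr1 //.
  by rewrite pnatr_eq0 -lt0n.
rewrite -cK ler_pXn2r ?nnegrE ?powR_ge0 ?numerical_radius_ge0 //.
apply: ge_sup; first by exists (normc (phi0 x)), phi0.
move=> _ [phi phi_state <-].
rewrite -(ler_pXn2r k_gt0) ?nnegrE ?powR_ge0 ?normc_ge0 // cK.
exact: bound.
Qed.

(** Arithmetic-geometric mean inequality for [phi (star x * x)] and
    [phi (x * star x)]. *)
Lemma state_seminorm_mul_le (phi : {scalar A}) x : state_space A phi ->
  state_seminorm phi x * state_seminorm phi (star x)
    <= cnorm (x * star x + star x * x) / 2.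
Proof.
move=> phi_state; set s := state_seminorm phi.
have sa : star (x * star x + star x * x) = x * star x + star x * x.
  by rewrite starD !starM !starK.
have := state_sa_le_cnorm phi_state sa.
have phi_star : phi (x * star x) = (s (star x) ^+ 2)%:C.
  by rewrite -state_posE // starK.
rewrite linearD /= phi_star state_posE //= -/s.
by have := sqr_ge0 (s x - s (star x)); nra.
Qed.

(** The same inequality one power higher, after the Jensen step
    [phi h ^+ 2 <= phi (h ^+ 2)] for [h = star x * x] and [h = x * star x]. *)
Lemma state_seminorm_sqr_mul_le (phi : {scalar A}) x : state_space A phi ->
  (state_seminorm phi x * state_seminorm phi (star x)) ^+ 2
    <= cnorm ((x * star x) ^+ 2 + (star x * x) ^+ 2) / 2.
Proof.
move=> phi_state; set s := state_seminorm phi.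
have sa1 : star (x * star x) = x * star x by rewrite starM starK.
have sa2 : star (star x * x) = star x * x by rewrite starM starK.
have sa : star ((x * star x) ^+ 2 + (star x * x) ^+ 2)
        = (x * star x) ^+ 2 + (star x * x) ^+ 2.
  by rewrite starD !starX.
have := state_sa_le_cnorm phi_state sa; rewrite linearD /=.
have := state_sa_sqr phi_state sa1; have := state_sa_sqr phi_state sa2.
have -> : complex.Re (phi (star x * x)) = s x ^+ 2 by rewrite state_posE.
have -> : complex.Re (phi (x * star x)) = s (star x) ^+ 2.
  by rewrite -[x in phi (x * _)]starK state_posE.
case: (phi ((x * star x) ^+ 2)) => u1 v1.
case: (phi ((star x * x) ^+ 2)) => u2 v2 /=.
have := sqr_ge0 (s x ^+ 2 - s (star x) ^+ 2).
by rewrite exprMn sqrrB; lra.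
Qed.

End NumericalRadius.

(** The estimate for a single state [phi]: [p], [q], [r] are the moduli of [phi] at
    the first three powers of the element, [g] is the product of its seminorm and
    that of its adjoint, [n] and [m] the norms of the element and of its square.
    Squaring the first Buzano inequality and multiplying by [p ^+ 2] gives
    [a ^+ 2 * p ^+ 6 <= (Ma * g) ^+ 2 * p ^+ 2 + 2 * Ma * g * (q * p ^+ 2)
    + (q * p) ^+ 2]. The last term is split with weights [f1 + f1' = 1]: one share
    is read as [q * (q * p ^+ 2)] and treated by the inequality with [c], the other
    by the square of the inequality with [b], in which [r ^+ 2] is split again with
    weights [f2 + f2' = 1]. *)
Lemma sextic_bound (R : realType)
    (p q r g n m K L W a b c Ma Mb Mc f1 f1' f2 f2' : R) :
  0 <= p -> 0 <= q -> 0 <= r -> 0 <= g -> 0 <= m ->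
  0 < a -> 0 < b -> 0 < c -> 0 <= Ma -> 0 <= Mb ->
  0 <= f1 -> 0 <= f1' -> f1 + f1' = 1 -> 0 <= f2 -> 0 <= f2' -> f2 + f2' = 1 ->
  a * p ^+ 2 <= Ma * g + q ->
  b * (q * p) <= Mb * (m * n) + r -> c * (q * p) <= Mc * (m * n) + r ->
  g <= L / 2 -> g ^+ 2 <= K / 2 -> q <= g -> p <= n -> r <= W -> r <= m * n ->
  p ^+ 6 <=
    Ma ^+ 2 / (2 * a ^+ 2) * K * n ^+ 2
  + f1' * Mb ^+ 2 / (a * b) ^+ 2 * m ^+ 2 * n ^+ 2
  + f1' * f2' / (a * b) ^+ 2 * W ^+ 2
  + f1' * (f2 + 2 * Mb) / (a * b) ^+ 2 * m * n * W
  + (f1 + 2 * Ma) * Mc / (2 * a ^+ 2 * c) * L * m * n ^+ 2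
  + (f1 + 2 * Ma) / (2 * a ^+ 2 * c) * L * n * W.
Proof.
move=> p0 q0 r0 g0 m0 a0 b0 c0 Ma0 Mb0 f10 f1'0 f1E f20 f2'0 f2E
  ineq_a ineq_b ineq_c gL gK qg pn rW rmn.
have n0 : 0 <= n by exact: le_trans pn.
have W0 : 0 <= W by exact: le_trans rW.
have mn0 : 0 <= m * n by exact: mulr_ge0.
(* [Y] bounds [q * p ^+ 2] and [Z] bounds [(q * p) ^+ 2] *)
pose Y := (Mc * (m * n) + W) * n / c.
pose Z := (Mb ^+ 2 * (m * n) ^+ 2 + 2 * Mb * (m * n) * W
           + f2 * (m * n * W) + f2' * W ^+ 2) / b ^+ 2.
have leY : q * p ^+ 2 <= Y.
  rewrite expr2 mulrA /Y [leRHS]mulrAC ler_pM ?mulr_ge0 //.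
  by rewrite ler_pdivlMr // mulrC; lra.
have leZ : (q * p) ^+ 2 <= Z.
  rewrite /Z ler_pdivlMr ?exprn_gt0 // mulrC -exprMn.
  have : (b * (q * p)) ^+ 2 <= (Mb * (m * n) + r) ^+ 2.
    by rewrite ler_pXn2r // nnegrE ?addr_ge0 ?mulr_ge0 // ltW.
  move/le_trans; apply; rewrite sqrrD exprMn.
  have rW2 : r ^+ 2 <= W ^+ 2 by rewrite ler_pXn2r.
  have rmnW : r ^+ 2 <= m * n * W by rewrite expr2 ler_pM.
  have e1 := ler_wpM2l f20 rmnW; have e2 := ler_wpM2l f2'0 rW2.
  have -> : r ^+ 2 = f2 * r ^+ 2 + f2' * r ^+ 2 by rewrite -mulrDl f2E mul1r.
  have := ler_wpM2l (mulr_ge0 Mb0 mn0) rW; lra.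
have p2n2 : p ^+ 2 <= n ^+ 2 by rewrite ler_pXn2r.
have t1 : Ma ^+ 2 * (g ^+ 2 * p ^+ 2) <= Ma ^+ 2 * (K / 2 * n ^+ 2).
  by rewrite ler_wpM2l ?sqr_ge0 // ler_pM ?sqr_ge0.
have t2 : Ma * (g * (q * p ^+ 2)) <= Ma * (L / 2 * Y).
  by rewrite ler_wpM2l // ler_pM // mulr_ge0 ?sqr_ge0.
have t3 : f1 * (q * (q * p ^+ 2)) <= f1 * (L / 2 * Y).
  by rewrite ler_wpM2l // ler_pM // ?(le_trans qg gL) // mulr_ge0 ?sqr_ge0.
have t4 := ler_wpM2l f1'0 leZ.
have t0 : (a * p ^+ 2) ^+ 2 * p ^+ 2 <= (Ma * g + q) ^+ 2 * p ^+ 2.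
  rewrite ler_wpM2r ?sqr_ge0 // ler_pXn2r // nnegrE.
    by rewrite mulr_ge0 ?sqr_ge0 // ltW.
  by rewrite addr_ge0 // mulr_ge0.
have total : a ^+ 2 * p ^+ 6 <= Ma ^+ 2 * (K / 2 * n ^+ 2) + f1' * Z
    + (f1 + 2 * Ma) * (L / 2 * Y).
  have -> : a ^+ 2 * p ^+ 6 = (a * p ^+ 2) ^+ 2 * p ^+ 2 by ring.
  apply: le_trans t0 _.
  have -> : (Ma * g + q) ^+ 2 * p ^+ 2 = Ma ^+ 2 * (g ^+ 2 * p ^+ 2)
      + 2 * (Ma * (g * (q * p ^+ 2))) + (f1 + f1') * (q * p) ^+ 2.
    by rewrite f1E; ring.
  have : f1 * (q * p) ^+ 2 = f1 * (q * (q * p ^+ 2)) by ring.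
  by move=> e; rewrite [(f1 + f1') * _]mulrDl e; lra.
rewrite -(ler_pM2l (exprn_gt0 2 a0)); apply: le_trans total _.
rewrite le_eqVlt; apply/orP; left; apply/eqP; rewrite /Y /Z.
by field; rewrite !gt_eqF.
Qed.

(** * The sextic inequality *)

Theorem theorem2p18 (R : realType) (A : cstarAlgType R) (a : A)
    (D1 D2 : set R)
    (D1_sym : forall t : R, D1 t -> D1 (1 - t))
    (D2_sym : forall t : R, D2 t -> D2 (1 - t))
    (f1 f2 : R -> R)
    (f1_ge0 : forall t : R, D1 t -> 0 <= f1 t)
    (f2_ge0 : forall t : R, D2 t -> 0 <= f2 t)
    (f1_sum : forall t : R, D1 t -> f1 t + f1 (1 - t) = 1)
    (f2_sum : forall t : R, D2 t -> f2 t + f2 (1 - t) = 1)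
    (xi1 xi2 : R) (xi1_D1 : D1 xi1) (xi2_D2 : D2 xi2)
    (alpha beta gamma : R[i])
    (alpha_neq0 : alpha != 0) (beta_neq0 : beta != 0)
    (gamma_neq0 : gamma != 0) :
  numerical_radius a ^+ 6 <=
    Num.max 1 (normc (alpha - 1) ^+ 2) / (2 * normc alpha ^+ 2)
      * cnorm ((a * star a) ^+ 2 + (star a * a) ^+ 2) * cnorm a ^+ 2
  + f1 (1 - xi1) * Num.max 1 (normc (beta - 1) ^+ 2)
      / normc (alpha * beta) ^+ 2
      * cnorm (a ^+ 2) ^+ 2 * cnorm a ^+ 2
  + f1 (1 - xi1) * f2 (1 - xi2) / normc (alpha * beta) ^+ 2
      * numerical_radius (a ^+ 3) ^+ 2
  + f1 (1 - xi1) * (f2 xi2 + 2 * Num.max 1 (normc (beta - 1)))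
      / normc (alpha * beta) ^+ 2
      * cnorm (a ^+ 2) * cnorm a * numerical_radius (a ^+ 3)
  + (f1 xi1 + 2 * Num.max 1 (normc (alpha - 1)))
      * Num.max 1 (normc (gamma - 1))
      / (2 * normc alpha ^+ 2 * normc gamma)
      * cnorm (a * star a + star a * a) * cnorm (a ^+ 2) * cnorm a ^+ 2
  + (f1 xi1 + 2 * Num.max 1 (normc (alpha - 1)))
      / (2 * normc alpha ^+ 2 * normc gamma)
      * cnorm (a * star a + star a * a) * cnorm a * numerical_radius (a ^+ 3).
Proof.
have max_ge1 (t : R) : 1 <= Num.max 1 t by rewrite le_max lexx.
have max_ge0 (t : R) : 0 <= Num.max 1 t by exact: le_trans ler01 (max_ge1 t).
have f1_sum' : f1 xi1 + f1 (1 - xi1) = 1 by exact: f1_sum.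
have f2_sum' : f2 xi2 + f2 (1 - xi2) = 1 by exact: f2_sum.
rewrite normcM !max1_sqr ?normc_ge0 //.
have bound p q r g := @sextic_bound R p q r g (cnorm a) (cnorm (a ^+ 2))
  (cnorm ((a * star a) ^+ 2 + (star a * a) ^+ 2))
  (cnorm (a * star a + star a * a)) (numerical_radius (a ^+ 3))
  (normc alpha) (normc beta) (normc gamma)
  (Num.max 1 (normc (alpha - 1))) (Num.max 1 (normc (beta - 1)))
  (Num.max 1 (normc (gamma - 1))) (f1 xi1) (f1 (1 - xi1))
  (f2 xi2) (f2 (1 - xi2)).
apply: numerical_radius_exp_le => //.
  (* the right-hand side is nonnegative: the bound holds for zero moduli *)
  have -> : 0 = (0 : R) ^+ 6 by rewrite expr0n.
  apply: (bound 0 0 0 0); rewrite ?expr0n ?mulr0 ?addr0 ?normc_gt0 ?f1_ge0 ?f2_ge0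
    ?cnorm_ge0 ?numerical_radius_ge0 ?divr_ge0 ?mulr_ge0 ?cnorm_ge0
    ?max_ge0 ?max_ge1 //; auto.
move=> phi phi_state; set s := state_seminorm phi.
have s_star : s (star a) <= cnorm a by rewrite -cnorm_star state_seminorm_le.
have s_sqr : s (a ^+ 2) <= cnorm (a ^+ 2) by exact: state_seminorm_le.
have s_ge0 x : 0 <= s x by exact: state_seminorm_ge0.
have buzano c : normc c * (normc (phi (a ^+ 2)) * normc (phi a)) <=
    Num.max 1 (normc (c - 1)) * (cnorm (a ^+ 2) * cnorm a)
    + normc (phi (a ^+ 3)).
  rewrite -normcM exprS; apply: le_trans (state_buzano phi_state _ _ _) _.
  by rewrite lerD2r ler_wpM2l ?ler_pM.
apply: (bound _ (normc (phi (a ^+ 2))) (normc (phi (a ^+ 3)))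
  (s a * s (star a))); rewrite ?normc_ge0 ?mulr_ge0 ?cnorm_ge0 ?normc_gt0
  ?f1_ge0 ?f2_ge0 //; auto.
- rewrite expr2 -normcM expr2; exact: state_buzano.
- exact: state_seminorm_mul_le.
- exact: state_seminorm_sqr_mul_le.
- by rewrite expr2 state_mul_le.
- exact: state_le_cnorm.
- exact: state_le_numerical_radius.
- rewrite exprS; apply: le_trans (state_mul_le phi_state _ _) _.
  by rewrite ler_pM.
Qed.
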